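(* Let $G$ be a finitely generated group with a finite symmetric generating set $S$ and let $X$ be a compact metric space. If $\Phi\in Act(G,X)$ is a commutative expansive action and the restriction $\Phi|_{CR(\Phi)}$ has the shadowing property, then $CR(\Phi)$ is isolated.
   Context: $Act(G,X)$ is the set of uniformly continuous actions of $G$ on a metric space $(X,d)$: maps $\Phi:G\times X\to X$ such that, writing $\Phi_g=\Phi(g,\cdot)$, one has $\Phi_e=\mathrm{id}_X$, $\Phi_{gh}=\Phi_g\circ\Phi_h$ for all $g,h\in G$, and each $\Phi_g$ is a homeomorphism with $\Phi_g$ and $\Phi_{g^{-1}}$ uniformly continuous (automatic if $X$ is compact). $\Phi$ is commutative if $\Phi_s\circ\Phi_{s'}=\Phi_{s'}\circ\Phi_s$ for all $s,s'\in S$. Expansive: there is $\mathfrak e>0$ such that for all $x\ne y$ in $X$ there is $g\in G$ with $d(\Phi_g(x),\Phi_g(y))>\mathfrak e$. For $\delta>0$, a $\delta$-pseudo orbit of $\Phi$ (with respect to $S$) is a map $f:G\to X$ with $d(\Phi_s(f(g)),f(sg))<\delta$ for all $s\in S$, $g\in G$. It is a $\delta$-pseudo orbit from $x$ to $y$ if there are distinct $h,k\in G$ with $f(h)=x$ and $f(k)=y$. The chain recurrent set $CR(\Phi)$ is the set of $x\in X$ such that for every $\delta>0$ there is a $\delta$-pseudo orbit of $\Phi$ from $x$ to $x$ (this set does not depend on the choice of $S$). For commutative $\Phi$ the set $CR(\Phi)$ is $\Phi$-invariant, so $\Phi$ restricts to an action $\Phi|_{CR(\Phi)}$ of $G$ on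 $CR(\Phi)$. Shadowing property (with respect to $S$) of an action on a metric space: for every $\epsilon>0$ there is $\delta>0$ such that for every $\delta$-pseudo orbit $f$ there is a point $x$ of the space with $d(\Phi_g(x),f(g))<\epsilon$ for all $g\in G$. (For $\Phi|_{CR(\Phi)}$, both the pseudo orbits and the tracing points are in $CR(\Phi)$.) $CR(\Phi)$ is isolated if there is a compact neighbourhood $U$ of $CR(\Phi)$ in $X$ such that $\bigcap_{g\in G}\Phi_g(U)=CR(\Phi)$. *)

(* Defs.v *)
From mathcomp Require Import all_boot all_order all_algebra.
From mathcomp Require Import all_classical all_reals all_analysis.

Set Implicit Arguments.
Unset Strict Implicit.
Unset Printing Implicit Defensive.

Import Order.TTheory GRing.Theory Num.Theory.
Local Open Scope classical_set_scope.
Local Open Scope ring_scope.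

Definition generates (G : groupType) (S : set G) : Prop :=
  smallest [set H : set G | group_closed [in H]] S = [set: G].

Definition finite_symmetric_generating (G : groupType) (S : set G) : Prop :=
  [/\ finite_set S, forall s, S s -> S (s^-1)%g & generates S].

Definition homeomorphism (X Y : topologicalType) (f : X -> Y) : Prop :=
  exists f' : Y -> X,
    [/\ cancel f f', cancel f' f, continuous f & continuous f'].

Record Act (R : realType) (G : groupType) (X : metricType R) : Type := {
  act_fun :> G -> X -> X ;
  act_1 : act_fun 1%g = id ;
  act_M : forall g h, act_fun (g * h)%g = act_fun g \o act_fun h ;
  act_homeo : forall g, homeomorphism (act_fun g) ;
  act_unif : forall g,
    unif_continuous (act_fun g) /\ unif_continuous (act_fun (g^-1)%g)
}.
Arguments Act {R} G X.

Section ActionNotions.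
Context {R : realType} {G : groupType} {X : metricType R}.
Implicit Types (S : set G) (Phi : Act G X) (A : set X) (f : G -> X).

Definition commutative_act S Phi : Prop :=
  forall s s', S s -> S s' -> Phi s \o Phi s' = Phi s' \o Phi s.

Definition expansive Phi : Prop :=
  exists2 c : R, 0 < c &
    forall x y : X, x <> y -> exists g, c < mdist (Phi g x) (Phi g y).

Definition pseudo_orbit S Phi (delta : R) f : Prop :=
  forall s g, S s -> mdist (Phi s (f g)) (f (s * g)%g) < delta.

Definition pseudo_orbit_from_to S Phi (delta : R) (x y : X) f : Prop :=
  pseudo_orbit S Phi delta f /\
  exists h k : G, [/\ h <> k, f h = x & f k = y].

Definition chain_recurrent S Phi : set X :=
  [set x | forall delta : R, 0 < delta ->
     exists f, pseudo_orbit_from_to S Phi delta x x f].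

(* Shadowing of the restriction of [Phi] to an invariant set [A], with the
   metric induced from [X]: a pseudo-orbit of the restriction is a pseudo-orbit
   of [Phi] with values in [A], and the tracing point has to lie in [A]. *)
Definition shadowing_on S Phi A : Prop :=
  forall eps : R, 0 < eps ->
  exists2 delta : R, 0 < delta &
    forall f, (forall g, A (f g)) -> pseudo_orbit S Phi delta f ->
    exists2 x, A x & forall g, mdist (Phi g x) (f g) < eps.

Definition isolated_chain_recurrent S Phi : Prop :=
  exists U : set X,
    [/\ compact U, set_nbhs (chain_recurrent S Phi) U &
        \bigcap_(g in [set: G]) (Phi g @` U) = chain_recurrent S Phi].

End ActionNotions.

(* Main.v *)
Require Import Defs.
From mathcomp Require Import all_boot all_order all_algebra.
From mathcomp Require Import all_classical all_reals all_analysis.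
From mathcomp Require Import lra.

Set Implicit Arguments.
Unset Strict Implicit.

Import Order.TTheory GRing.Theory Num.Theory.
Local Open Scope classical_set_scope.

(** Let [A] be the chain recurrent set.  If the whole orbit of a point [x] stays
close to [A], pick for every [g] a point [y g] of [A] near [Phi g x].  By uniform
continuity of the finitely many generators, [y] is a pseudo-orbit with values in
[A], so shadowing on [A] yields a point [z] of [A] tracing [y].  The orbits of
[z] and [x] are then uniformly close, whence [z = x] by expansivity, and [x] lies
in [A] ([mem_of_orbit_near]).

A small closed neighbourhood [U] of [A] ([compact_neighborhood]) is thus an
isolating one as soon as [A], being contained in [U], is contained in all the
images of [U]; this amounts to the invariance of [A].  Here commutativity enters:
a generator commutes with the generators, so it maps pseudo-orbits to
pseudo-orbits ([chain_recurrent_invariant]). *)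

Lemma invariant_of_generators (R : realType) (G : groupType) (S : set G)
    (X : metricType R) (Phi : Act G X) (A : set X) :
  finite_symmetric_generating S ->
  (forall s x, S s -> A x -> A (Phi s x)) ->
  forall g x, A x -> A (Phi g x).
Proof.
move=> [_ symS genS] AS g x Ax.
(* Both conditions are kept so that [H] is closed under inverses. *)
pose H : set G :=
  [set h | forall y, A y -> A (Phi h y) /\ A (Phi (h^-1)%g y)].
suff /(_ x Ax)[] : H g by [].
have : [set: G] g by [].
rewrite -genS; apply: smallest_sub => [|s Ss y Ay]; last first.
  by split; apply: AS => //; exact: symS.
split; first by rewrite inE => y Ay; rewrite invg1 act_1.
move=> u v; rewrite !inE => Hu Hv y Ay; split.
  by rewrite act_M /=; apply: (Hu _ _).1; exact: (Hv _ _).2.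
by rewrite invgM invgK act_M /=; apply: (Hv _ _).1; exact: (Hu _ _).2.
Qed.

Lemma act_unif_mdist (R : realType) (G : groupType) (X : metricType R)
    (Phi : Act G X) (g : G) (e : R) :
  (0 < e)%R -> exists2 d : R, (0 < d)%R &
    forall x y, (mdist x y < d)%R -> (mdist (Phi g x) (Phi g y) < e)%R.
Proof.
move=> e0; have [/unif_continuousP/(_ e e0)[d d0 dP] _] := act_unif Phi g.
by exists d => // x y; have := dP (x, y); rewrite !ballEmdist.
Qed.

Lemma finite_equicontinuous (R : realType) (G : groupType) (S : set G)
    (X : metricType R) (Phi : Act G X) (e : R) :
  finite_set S -> (0 < e)%R -> exists2 d : R, (0 < d)%R &
    forall s x y, S s -> (mdist x y < d)%R ->
      (mdist (Phi s x) (Phi s y) < e)%R.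
Proof.
move=> /finite_seqP[r ->] e0; elim: r => [|t r [d d0 dP]].
  by exists 1%R; rewrite ?ltr01.
have [d' d'0 d'P] := act_unif_mdist Phi t e0.
exists (Num.min d d'); first by rewrite lt_min d0.
move=> s x y /=; rewrite inE lt_min => /orP[/eqP->|sr] /andP[xd xd'].
  exact: d'P.
exact: dP.
Qed.

Lemma chain_recurrent_generator (R : realType) (G : groupType) (S : set G)
    (X : metricType R) (Phi : Act G X) :
  commutative_act S Phi -> forall t x, S t ->
  chain_recurrent S Phi x -> chain_recurrent S Phi (Phi t x).
Proof.
move=> comm t x St CRx e e0.
have [d d0 dP] := act_unif_mdist Phi t e0.
have [f [fpo [h [k [hk fh fk]]]]] := CRx d d0.
exists (Phi t \o f); split; last by exists h, k; rewrite /= fh fk.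
move=> s g Ss /=.
have -> : Phi s (Phi t (f g)) = Phi t (Phi s (f g)).
  exact: (congr1 (@^~ (f g)) (comm s t Ss St)).
exact/dP/fpo.
Qed.

Lemma chain_recurrent_invariant (R : realType) (G : groupType) (S : set G)
    (X : metricType R) (Phi : Act G X) :
  finite_symmetric_generating S -> commutative_act S Phi ->
  forall g x, chain_recurrent S Phi x -> chain_recurrent S Phi (Phi g x).
Proof.
move=> SG comm; apply: (invariant_of_generators SG) => s x.
exact: chain_recurrent_generator.
Qed.

(** Expansivity turns shadowing on [A] into maximality of [A] among the sets
invariant and close to [A]: points of [A] chosen near those of an orbit close to
[A] form a pseudo-orbit, and the point tracing it has to be the initial one. *)
Lemma mem_of_orbit_near (R : realType) (G : groupType) (S : set G)
    (X : metricType R) (Phi : Act G X) (A : set X) :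
  finite_set S -> expansive Phi -> shadowing_on S Phi A ->
  exists2 r : R, (0 < r)%R & forall x,
    (forall g, exists2 y, A y & (mdist y (Phi g x) < r)%R) -> A x.
Proof.
move=> finS [c c0 cP] shad.
have c20 : (0 < c / 2)%R by lra.
have [d d0 dP] := shad _ c20.
have d20 : (0 < d / 2)%R by lra.
have [m m0 mP] := finite_equicontinuous Phi finS d20.
(* [m] and [d / 2] make the chosen points a [d]-pseudo-orbit; [c / 2] leaves
   room for the shadowing error within the expansivity constant [c]. *)
exists (Num.min m (Num.min (d / 2) (c / 2)))%R.
  by rewrite !lt_min m0 d20 c20.
move=> x near_A.
have [y yP] : {y : G -> X & forall g, A (y g) /\
    (mdist (y g) (Phi g x) < Num.min m (Num.min (d / 2) (c / 2)))%R}.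
  apply: (@choice _ _ (fun g z => A z /\ (mdist z (Phi g x) < _)%R)) => g.
  by have [z Az zg] := near_A g; exists z.
have ym g : (mdist (y g) (Phi g x) < m)%R.
  by have [_] := yP g; rewrite lt_min => /andP[].
have yd g : (mdist (y g) (Phi g x) < d / 2)%R.
  by have [_] := yP g; rewrite !lt_min => /and3P[].
have yc g : (mdist (y g) (Phi g x) < c / 2)%R.
  by have [_] := yP g; rewrite !lt_min => /and3P[].
have y_po : pseudo_orbit S Phi d y.
  move=> s g Ss; have := mP s _ _ Ss (ym g).
  have := yd (s * g)%g; rewrite act_M /= [X in (X < _)%R -> _]metric_sym.
  have := metric_triangle (Phi s (y g)) (Phi s (Phi g x)) (y (s * g)%g).
  lra.
have [z Az zy] := dP y (fun g => (yP g).1) y_po.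
suff <- : z = x by [].
apply: contrapT => /cP[g].
have := metric_triangle (Phi g z) (y g) (Phi g x).
have := zy g; have := yc g; lra.
Qed.

Lemma compact_neighborhood (R : realType) (X : metricType R) (A : set X)
    (r : R) :
  compact [set: X] -> (0 < r)%R ->
  exists U : set X, [/\ compact U, set_nbhs A U &
    forall x, U x -> exists2 y, A y & (mdist y x < r)%R].
Proof.
move=> cX r0; have r20 : (0 < r / 2)%R by lra.
(* Half the radius: taking the closure may increase the distance to [A]. *)
pose V := [set x | exists2 y, A y & (mdist y x < r / 2)%R].
exists (closure V); split.
- exact: (subclosed_compact (@closed_closure _ V) cX).
- move=> x Ax; apply: (filterS (@subset_closure _ V)).
  apply: (filterS _ (nbhsx_ballx x _ r20)) => z.
  by rewrite ballEmdist => xz; exists x.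
- move=> x /(_ _ (nbhsx_ballx x _ r20))[z [[y Ay yz]]].
  rewrite ballEmdist /= => xz; exists y => //.
  have := metric_triangle y z x; rewrite (metric_sym z x); lra.
Qed.

Unset Implicit Arguments.

Theorem theorem3p4 (R : realType) (G : groupType) (S : set G)
    (X : metricType R) (Phi : Act G X) :
  finite_symmetric_generating S ->
  compact [set: X] ->
  commutative_act S Phi ->
  expansive Phi ->
  shadowing_on S Phi (chain_recurrent S Phi) ->
  isolated_chain_recurrent S Phi.
Proof.
move=> SG cX comm expPhi shad.
have actKV g : cancel (Phi (g^-1)%g) (Phi g).
  move=> x; have := act_M Phi g (g^-1)%g.
  by rewrite mulgV act_1 => /(congr1 (@^~ x)).
have [finS _ _] := SG.
have [r r0 rP] := mem_of_orbit_near finS expPhi shad.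
have [U [cU nU Unear]] := compact_neighborhood (chain_recurrent S Phi) cX r0.
exists U; split => //; apply/seteqP; split => [x xU|x CRx g _].
  apply: rP => g; apply: Unear.
  have [u Uu <-] := xU (g^-1)%g I.
  by rewrite actKV.
exists (Phi (g^-1)%g x); last exact: actKV.
by apply: nbhs_singleton; apply: nU; exact: chain_recurrent_invariant.
Qed.
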